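(* Consider the system $$\frac{du}{dt}=T(u)+\frac1\varepsilon Q(u),\qquad u(t)\in\mathbb R^N,\ \varepsilon>0,$$ where $T,Q:\mathbb R^N\to\mathbb R^N$ satisfy the following five properties: (1) there is $\Delta t_{\mathrm{FE}}>0$ such that $u>0$ implies $u+\Delta t\,T(u)>0$ for all $0\le\Delta t\le\Delta t_{\mathrm{FE}}$; (2) if $u>0$ and $v=u+\Delta t\,Q(v)$, then $v>0$, for all $\Delta t\ge0$; (3) there is a linear operator $\mathcal R:\mathbb R^N\to\mathbb R^n$, $n<N$, such that $\mathcal RQ(u)=0$ for all $u$; (4) there is a (possibly nonlinear) operator $E:\mathbb R^n\to\mathbb R^N$ such that $Q(u)=0$ implies $u=E(\mathcal Ru)$, and moreover $\mathcal RE(\mathcal Ru)=\mathcal Ru$ for all $u$; (5) $\dot Q(u):=Q'(u)Q(u)=-C_{\mathcal Ru}\,Q(u)$, where $C_{\mathcal Ru}$ is a positive function depending only on $\mathcal Ru$. Consider the $s$-stage multi-derivative IMEX Runge--Kutta scheme, with $r>0$, $$u^{(i)}=r_iu^n+\sum_{j=1}^{i-1}p_{ij}u^{(j)}+\sum_{j=1}^{i-1}w_{ij}\Big(u^{(j)}+\frac{\Delta t}{r}T(u^{(j)})\Big)+\frac{\Delta t}{\varepsilon}d_{ii}Q(u^{(i)})+\frac{\Delta t^2}{\varepsilon^2}\dot d_{ii}\,\dot Q(u^{(i)}),\quad i=1,\dots,s,$$ $$u^{n+1}=u^{(s)},$$ with coefficient matrices $\mathbf P=(p_{ij})$, $\mathbf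 W=(w_{ij})$, $\mathbf R=I-\mathbf P-\mathbf W$, $\mathbf D=\mathrm{diag}(d_{ii})$, $\dot{\mathbf D}=\mathrm{diag}(\dot d_{ii})$, $r_i=(\mathbf R\mathbf e)_i$, satisfying the element-wise inequalities $$\mathbf R\mathbf e\ge0,\qquad\mathbf P\ge0,\qquad\mathbf W\ge0,\qquad\mathbf D\ge0,\qquad\dot{\mathbf D}\le0.$$ Then the scheme preserves the positivity of the solution (that is, $u^n>0$ implies $u^{n+1}>0$) for all $\Delta t\le r\,\Delta t_{\mathrm{FE}}$. Furthermore, if the strict inequality $$d_{ii}+|\dot d_{ii}|>0\quad\text{for all } i=1,\dots,s$$ is also satisfied, then the scheme is asymptotic preserving (AP), i.e. when $\Delta t$ is fixed, as $\varepsilon\to0$, the scheme automatically reduces to an explicit Runge--Kutta scheme, with the same order as the original scheme, applied to the limiting system $$\frac{d\omega}{dt}=\mathcal RT(E(\omega)),\qquad \omega=\mathcal Ru .$$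
   Context: Inequalities such as $u>0$ for $u\in\mathbb R^N$ are componentwise. $Q'(u)$ denotes the Fréchet derivative, $Q'(u)v=\lim_{\delta\to0}\frac{Q(u+\delta v)-Q(u)}{\delta}$. The linear operator $\mathcal R$ is unrelated to the coefficient matrix $\mathbf R$. The matrices $\mathbf P,\mathbf W,\mathbf R,\mathbf D,\dot{\mathbf D}$ are real $s\times s$ matrices: $\mathbf P,\mathbf W$ are strictly lower triangular, $\mathbf R=I-\mathbf P-\mathbf W$, $\mathbf D,\dot{\mathbf D}$ are diagonal, and $\mathbf e\in\mathbb R^s$ is the vector of ones, so $r_i$ is the $i$th row sum of $\mathbf R$. The stage equations are implicit; the claim concerns stage values satisfying them. Time-steps $\Delta t$ are positive. Limiting system: applying $\mathcal R$ to the ODE gives $\frac{d\omega}{dt}=\mathcal RT(u)$ with $\omega=\mathcal Ru$; as $\varepsilon\to0$ the ODE (formally) forces $Q(u)\to0$, hence $u\to E(\omega)$, which gives the closed system $\frac{d\omega}{dt}=\mathcal RT(E(\omega))$. Asymptotic preserving (AP): for a fixed $\Delta t$, when $\varepsilon\to0$, the scheme for $\frac{du}{dt}=T(u)+\frac1\varepsilon Q(u)$ automatically reduces to a high order time discretization for the limiting system. ''Reduces'' is meant at the level of the formal limit $\varepsilon\to0$ of the scheme's equations, in which $Q(u^{(i)})\to0$ is understood to entail $u^{(i)}\to E(\mathcal Ru^{(i)})$ and the resulting relations for $\omega^n=\mathcal Ru^n$, $\omega^{(i)}=\mathcal Ru^{(i)}$, $\omega^{n+1}=\mathcal Ru^{n+1}$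 form the scheme for the limiting system. The order of the original scheme is its classical order of accuracy as a time discretization of systems $u_t=F(u)+G(u)$ (here $F=T$, $G=\frac1\varepsilon Q$, $\dot G=G'G=\frac1{\varepsilon^2}\dot Q$). *)

(* Defs.v *)
From HB Require Import structures.
From mathcomp Require Import all_boot all_order all_algebra.
From mathcomp Require Import all_classical all_reals all_analysis.

Set Implicit Arguments.
Unset Strict Implicit.
Unset Printing Implicit Defensive.

Import Order.TTheory GRing.Theory Num.Theory.
Import numFieldNormedType.Exports.

Local Open Scope classical_set_scope.
Local Open Scope ring_scope.

Definition mx_pos (R : realType) (a b : nat) (A : 'M[R]_(a, b)) : Prop :=
  forall i j, 0 < A i j.

Definition mx_nonneg (R : realType) (a b : nat) (A : 'M[R]_(a, b)) : Prop :=
  forall i j, 0 <= A i j.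

Definition strictly_lower (R : realType) (s : nat) (A : 'M[R]_s) : Prop :=
  forall i j : 'I_s, (i <= j)%N -> A i j = 0.

(* The vector field G'(u) G(u), i.e. the second time derivative of u along
   du/dt = G(u). *)
Definition flow_dot (R : realType) (m : nat) (G : 'cV[R]_m -> 'cV[R]_m)
    (u : 'cV[R]_m) : 'cV[R]_m :=
  'd G u (G u).

Record relaxation_system (R : realType) (N n : nat)
    (T Q : 'cV[R]_N -> 'cV[R]_N) (Rop : {linear 'cV[R]_N -> 'cV[R]_n})
    (E : 'cV[R]_n -> 'cV[R]_N) (C : 'cV[R]_n -> R) (dtFE : R) : Prop := {
  dtFE_gt0 : 0 < dtFE;
  forward_euler_pos : forall (u : 'cV[R]_N) (dt : R),
    mx_pos u -> 0 <= dt -> dt <= dtFE -> mx_pos (u + dt *: T u);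
  backward_euler_pos : forall (u v : 'cV[R]_N) (dt : R),
    0 <= dt -> mx_pos u -> v = u + dt *: Q v -> mx_pos v;
  Rop_Q : forall u : 'cV[R]_N, Rop (Q u) = 0;
  equilibrium : forall u : 'cV[R]_N, Q u = 0 -> u = E (Rop u);
  Rop_E : forall u : 'cV[R]_N, Rop (E (Rop u)) = Rop u;
  Q_differentiable : forall u : 'cV[R]_N, differentiable Q u;
  C_gt0 : forall u : 'cV[R]_N, 0 < C (Rop u);
  Q_dotE : forall u : 'cV[R]_N, flow_dot Q u = - C (Rop u) *: Q u
}.

Definition Rmx (R : realType) (s : nat) (P W : 'M[R]_s) : 'M[R]_s :=
  1%:M - P - W.

(* The column vector R e of row sums, with entries r_i. *)
Definition rowsum (R : realType) (s : nat) (P W : 'M[R]_s) : 'cV[R]_s :=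
  Rmx P W *m const_mx 1.

(* The number of stages is s.+1, so that the last stage u^(s) exists; it is
   the one with index ord_max. *)

(* One step of size dt, from u0 to u1 with stage values U, of the IMEX scheme
   for u_t = F(u) + G(u); Gd stands for the field G'G. *)
Definition imex_step (R : realType) (s m : nat) (P W D Dd : 'M[R]_s.+1) (r : R)
    (F G Gd : 'cV[R]_m -> 'cV[R]_m) (dt : R)
    (u0 : 'cV[R]_m) (U : 'I_s.+1 -> 'cV[R]_m) (u1 : 'cV[R]_m) : Prop :=
  (forall i : 'I_s.+1,
     U i = rowsum P W i ord0 *: u0
         + \sum_(j < s.+1 | (j < i)%N) P i j *: U j
         + \sum_(j < s.+1 | (j < i)%N) W i j *: (U j + (dt / r) *: F (U j))
         + (dt * D i i) *: G (U i)
         + (dt ^+ 2 * Dd i i) *: Gd (U i))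
  /\ u1 = U ord_max.

(* The scheme for u_t = T(u) + Q(u) / eps: here G = Q / eps, and
   G'G = Q'Q / eps^2. *)
Definition stiff_imex_step (R : realType) (s N : nat) (P W D Dd : 'M[R]_s.+1)
    (r : R) (T Q : 'cV[R]_N -> 'cV[R]_N) (eps dt : R)
    (u0 : 'cV[R]_N) (U : 'I_s.+1 -> 'cV[R]_N) (u1 : 'cV[R]_N) : Prop :=
  imex_step P W D Dd r T (fun u => eps^-1 *: Q u)
    (fun u => (eps ^+ 2)^-1 *: flow_dot Q u) dt u0 U u1.

(* One step of the explicit Runge-Kutta scheme for w_t = H(w) whose Shu-Osher
   coefficients are R e, P and W. *)
Definition erk_step (R : realType) (s m : nat) (P W : 'M[R]_s.+1) (r : R)
    (H : 'cV[R]_m -> 'cV[R]_m) (dt : R)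
    (w0 : 'cV[R]_m) (w : 'I_s.+1 -> 'cV[R]_m) (w1 : 'cV[R]_m) : Prop :=
  (forall i : 'I_s.+1,
     w i = rowsum P W i ord0 *: w0
         + \sum_(j < s.+1 | (j < i)%N) P i j *: w j
         + \sum_(j < s.+1 | (j < i)%N) W i j *: (w j + (dt / r) *: H (w j)))
  /\ w1 = w ord_max.

Fixpoint class_C (R : realType) (m k : nat) (F : 'cV[R]_m -> 'cV[R]_m) : Prop :=
  match k with
  | 0%N => continuous F
  | k'.+1 => (forall x, differentiable F x)
             /\ forall v, class_C k' (fun x => 'd F x v)
  end.

Definition smooth (R : realType) (m : nat) (F : 'cV[R]_m -> 'cV[R]_m) : Prop :=
  forall k, class_C k F.

Definition solves_near0 (R : realType) (m : nat) (H : 'cV[R]_m -> 'cV[R]_m)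
    (y : R -> 'cV[R]_m) : Prop :=
  \forall t \near (0 : R), is_derive t (1 : R) y (H (y t)).

Definition local_error_order (R : realType) (m p : nat) (y y1 : R -> 'cV[R]_m)
    : Prop :=
  exists K : R, \forall h \near 0^'+, `|y1 h - y h| <= K * h ^+ p.+1.

(* Classical order (at least) p: on every smooth problem, starting from exact
   data, the error after one step of size h is O(h^(p+1)).  The stages are
   implicit; the relevant solutions of the stage equations are those close to
   the initial value for small h. *)
Definition imex_order (R : realType) (s : nat) (P W D Dd : 'M[R]_s.+1) (r : R)
    (p : nat) : Prop :=
  forall (m : nat) (F G : 'cV[R]_m -> 'cV[R]_m) (y : R -> 'cV[R]_m)
         (U : R -> 'I_s.+1 -> 'cV[R]_m) (y1 : R -> 'cV[R]_m),
    smooth F -> smooth G ->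
    solves_near0 (fun x => F x + G x) y ->
    (\forall h \near 0^'+,
       imex_step P W D Dd r F G (flow_dot G) h (y 0) (U h) (y1 h)) ->
    (forall i, U h i @[h --> 0^'+] --> y 0) ->
    local_error_order p y y1.

Definition erk_order (R : realType) (s : nat) (P W : 'M[R]_s.+1) (r : R)
    (p : nat) : Prop :=
  forall (m : nat) (H : 'cV[R]_m -> 'cV[R]_m) (y : R -> 'cV[R]_m)
         (w : R -> 'I_s.+1 -> 'cV[R]_m) (y1 : R -> 'cV[R]_m),
    smooth H -> solves_near0 H y ->
    (\forall h \near 0^'+, erk_step P W r H h (y 0) (w h) (y1 h)) ->
    local_error_order p y y1.

(* The formal limit eps -> 0 of the scheme's unknowns: the values converge, and
   so do the terms T, Q and Q'Q of the equations, to their values at the limit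
   (automatic when T, Q and Q'Q are continuous). *)
Record formal_limit (R : realType) (s N : nat) (T Q : 'cV[R]_N -> 'cV[R]_N)
    (u0 : R -> 'cV[R]_N) (U : R -> 'I_s.+1 -> 'cV[R]_N) (u1 : R -> 'cV[R]_N)
    (u0l : 'cV[R]_N) (Ul : 'I_s.+1 -> 'cV[R]_N) (u1l : 'cV[R]_N) : Prop := {
  limit_u0 : u0 eps @[eps --> 0^'+] --> u0l;
  limit_U : forall i, U eps i @[eps --> 0^'+] --> Ul i;
  limit_u1 : u1 eps @[eps --> 0^'+] --> u1l;
  limit_T : forall i, T (U eps i) @[eps --> 0^'+] --> T (Ul i);
  limit_Q : forall i, Q (U eps i) @[eps --> 0^'+] --> Q (Ul i);
  limit_Qdot : forall i,
    flow_dot Q (U eps i) @[eps --> 0^'+] --> flow_dot Q (Ul i)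
}.

(* For fixed dt, in the limit eps -> 0 the stages are driven to equilibrium and
   the quantities w = Rop u satisfy the explicit Runge-Kutta scheme for the
   limiting system w_t = Rop (T (E w)). *)
Definition reduces_to_erk (R : realType) (s N n : nat) (P W D Dd : 'M[R]_s.+1)
    (r : R) (T Q : 'cV[R]_N -> 'cV[R]_N) (Rop : {linear 'cV[R]_N -> 'cV[R]_n})
    (E : 'cV[R]_n -> 'cV[R]_N) (dt : R) : Prop :=
  forall (u0 : R -> 'cV[R]_N) (U : R -> 'I_s.+1 -> 'cV[R]_N)
         (u1 : R -> 'cV[R]_N) (u0l : 'cV[R]_N) (Ul : 'I_s.+1 -> 'cV[R]_N)
         (u1l : 'cV[R]_N),
    (\forall eps \near 0^'+,
       stiff_imex_step P W D Dd r T Q eps dt (u0 eps) (U eps) (u1 eps)) ->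
    formal_limit T Q u0 U u1 u0l Ul u1l ->
    [/\ forall i, Q (U eps i) @[eps --> 0^'+] --> (0 : 'cV[R]_N),
        forall i, Ul i = E (Rop (Ul i))
      & erk_step P W r (fun w => Rop (T (E w))) dt
          (Rop u0l) (fun i => Rop (Ul i)) (Rop u1l)].

Definition asymptotic_preserving (R : realType) (s N n : nat)
    (P W D Dd : 'M[R]_s.+1) (r : R) (T Q : 'cV[R]_N -> 'cV[R]_N)
    (Rop : {linear 'cV[R]_N -> 'cV[R]_n}) (E : 'cV[R]_n -> 'cV[R]_N) : Prop :=
  (forall dt : R, 0 < dt -> reduces_to_erk P W D Dd r T Q Rop E dt)
  /\ (forall p : nat, imex_order P W D Dd r p -> erk_order P W r p).

(* Main.v *)
Require Import Defs.
From HB Require Import structures.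
From mathcomp Require Import all_boot all_order all_algebra.
From mathcomp Require Import all_classical all_reals all_analysis.
From mathcomp Require Import ring lra.

(** The argument rests on two observations.

    First, the row sums r_i together with the rows of P and W are nonnegative
    and add up to 1 (lemma [stage_weights]), so the explicit part of each stage
    is a convex combination of u^n, of earlier stages and of forward Euler
    updates of earlier stages with step dt / r.  Positivity of those
    ingredients therefore passes to the explicit part.

    Second, Q'Q is a negative multiple of Q, so with D >= 0 and Dd <= 0 both
    implicit terms are nonnegative multiples of Q at the new stage: the stage
    is a single backward Euler step for Q started from the explicit part, with
    a step that happens to depend on the stage value.  Induction on the stages
    gives positivity without restriction from eps.

    For the asymptotic preserving property, multiply a stage equation by
    eps ^ 2 and let eps go to 0: only Dd_ii Q'Q survives, so Q vanishes at the
    limit stage if Dd_ii is nonzero.  Otherwise D_ii > 0 and multiplying by eps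
    gives the same conclusion ([stiff_balance]).  So all limit stages are
    equilibria.  On the other hand Rop annihilates Q, hence also Q'Q, and
    turns every stage equation, for every eps, into the corresponding explicit
    Runge-Kutta relation; the latter survives in the limit by continuity, and T
    is then evaluated at equilibria.

    The order is inherited because the explicit scheme applied to w' = H(w) is
    the IMEX scheme applied to the splitting F = H, G = 0.  The order condition
    of the IMEX scheme concerns stages that tend to the initial value; those of
    an explicit scheme do so automatically, as their weights add up to 1
    ([erk_stages_cvg]). *)

Import Order.TTheory GRing.Theory Num.Theory.
Import numFieldNormedType.Exports.

Local Open Scope classical_set_scope.
Local Open Scope ring_scope.

(** * The explicit part of a stage *)

(** The values V j of the vector field at the stages are kept independent of
    the stages U j, which makes the expression linear in (u0, U, V): linear
    maps and limits can then be applied to it without knowing the field. *)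
Definition explicit_part {R : realType} {s m : nat} (P W : 'M[R]_s.+1) (a : R)
    (u0 : 'cV[R]_m) (U V : 'I_s.+1 -> 'cV[R]_m) (i : 'I_s.+1) : 'cV[R]_m :=
  rowsum P W i ord0 *: u0
  + \sum_(j < s.+1 | (j < i)%N) P i j *: U j
  + \sum_(j < s.+1 | (j < i)%N) W i j *: (U j + a *: V j).

Lemma strictly_lower_sum {R : realType} {s : nat} (A : 'M[R]_s) (i : 'I_s) :
  strictly_lower A -> \sum_(j < s | (j < i)%N) A i j = \sum_j A i j.
Proof.
move=> Alow; rewrite big_mkcond; apply: eq_bigr => j _.
by case: ltnP => // /Alow ->.
Qed.

(** This is R e = e - P e - W e, read row by row. *)
Lemma stage_weights {R : realType} {s : nat} (P W : 'M[R]_s.+1) (i : 'I_s.+1) :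
  strictly_lower P -> strictly_lower W ->
  rowsum P W i ord0 + \sum_(j < s.+1 | (j < i)%N) P i j
    + \sum_(j < s.+1 | (j < i)%N) W i j = 1.
Proof.
move=> Plow Wlow; rewrite !strictly_lower_sum // /rowsum /Rmx.
rewrite !mulmxBl mul1mx !mxE.
have rowE (A : 'M[R]_s.+1) : \sum_j A i j * const_mx 1 j ord0 = \sum_j A i j.
  by apply: eq_bigr => j _; rewrite mxE mulr1.
by rewrite !rowE; ring.
Qed.

Lemma explicit_part_cst {R : realType} {s m : nat} (P W : 'M[R]_s.+1)
    (u0 : 'cV[R]_m) (V : 'I_s.+1 -> 'cV[R]_m) (i : 'I_s.+1) :
  strictly_lower P -> strictly_lower W ->
  explicit_part P W 0 u0 (fun=> u0) V i = u0.
Proof.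
move=> Plow Wlow; rewrite /explicit_part.
under [X in _ + X]eq_bigr do rewrite scale0r addr0.
by rewrite -!scaler_suml -!scalerDl stage_weights // scale1r.
Qed.

Lemma linear_explicit_part {R : realType} {s m n : nat}
    (L : {linear 'cV[R]_m -> 'cV[R]_n}) (P W : 'M[R]_s.+1) (a : R)
    (u0 : 'cV[R]_m) (U V : 'I_s.+1 -> 'cV[R]_m) (i : 'I_s.+1) :
  L (explicit_part P W a u0 U V i)
  = explicit_part P W a (L u0) (fun j => L (U j)) (fun j => L (V j)) i.
Proof.
rewrite /explicit_part !linearD !linear_sum /= linearZ; congr (_ + _ + _).
  by apply: eq_bigr => j _; rewrite linearZ.
by apply: eq_bigr => j _; rewrite linearZ linearD linearZ.
Qed.

Lemma cvg_bigsum {R : realType} {m : nat} {X I : Type} {F : set_system X}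
    {FF : Filter F} (l : seq I) (p : pred I) (f : I -> X -> 'cV[R]_m)
    (g : I -> 'cV[R]_m) :
  (forall j, p j -> f j x @[x --> F] --> g j) ->
  \sum_(j <- l | p j) f j x @[x --> F] --> \sum_(j <- l | p j) g j.
Proof. by move=> fg; apply: cvg_big => //; exact: add_continuous. Qed.

Lemma cvg_explicit_part {R : realType} {s m : nat} {X : Type}
    {F : set_system X} {FF : Filter F} (P W : 'M[R]_s.+1)
    (a : X -> R) (u0 : X -> 'cV[R]_m) (U V : X -> 'I_s.+1 -> 'cV[R]_m)
    (al : R) (u0l : 'cV[R]_m) (Ul Vl : 'I_s.+1 -> 'cV[R]_m) (i : 'I_s.+1) :
  a x @[x --> F] --> al -> u0 x @[x --> F] --> u0l ->
  (forall j : 'I_s.+1, (j < i)%N -> U x j @[x --> F] --> Ul j) ->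
  (forall j : 'I_s.+1, (j < i)%N -> V x j @[x --> F] --> Vl j) ->
  explicit_part P W (a x) (u0 x) (U x) (V x) i @[x --> F]
    --> explicit_part P W al u0l Ul Vl i.
Proof.
move=> aP u0P UP VP; rewrite /explicit_part.
apply: cvgD; first (apply: cvgD; first by apply: cvgZ => //; exact: cvg_cst).
  apply: (cvg_bigsum _ _ (fun j x => P i j *: U x j)) => j ji.
  by apply: cvgZ; [exact: cvg_cst | exact: UP].
apply: (cvg_bigsum _ _ (fun j x => W i j *: (U x j + a x *: V x j))) => j ji.
apply: cvgZ; first exact: cvg_cst.
by apply: cvgD; [exact: UP | apply: cvgZ => //; exact: VP].
Qed.

(** * Positivity *)

Lemma psum_gt0 {R : realType} {I : finType} (p : pred I) (c x : I -> R) :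
  (forall j, 0 <= c j) -> (forall j, p j -> 0 < x j) ->
  (0 < \sum_(j | p j) c j * x j) = (0 < \sum_(j | p j) c j).
Proof.
move=> c_ge0 x_gt0.
rewrite !lt0r !sumr_ge0 // => [|j pj]; last by rewrite mulr_ge0 // ltW ?x_gt0.
rewrite !andbT !psumr_neq0 // => [|j pj]; last by rewrite mulr_ge0 // ltW ?x_gt0.
apply: eq_has => j /=; case pj: (p j) => //=.
by rewrite pmulr_lgt0 // x_gt0.
Qed.

(** A convex combination of positive vectors is positive: the weights add up to
    1, so one of the three groups of weights has a positive sum. *)
Lemma explicit_part_pos {R : realType} {s m : nat} (P W : 'M[R]_s.+1) (a : R)
    (u0 : 'cV[R]_m) (U V : 'I_s.+1 -> 'cV[R]_m) (i : 'I_s.+1) :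
  strictly_lower P -> strictly_lower W ->
  mx_nonneg (rowsum P W) -> mx_nonneg P -> mx_nonneg W ->
  mx_pos u0 -> (forall j : 'I_s.+1, (j < i)%N -> mx_pos (U j)) ->
  (forall j : 'I_s.+1, (j < i)%N -> mx_pos (U j + a *: V j)) ->
  mx_pos (explicit_part P W a u0 U V i).
Proof.
move=> Plow Wlow r_ge0 P_ge0 W_ge0 u0_gt0 U_gt0 UV_gt0 k l.
rewrite /explicit_part mxE [X in _ < X + _]mxE [X in _ < X + _ + _]mxE.
rewrite !summxE.
under [X in _ < _ + X + _]eq_bigr do rewrite mxE.
under [X in _ < _ + X]eq_bigr do rewrite mxE.
have UE := psum_gt0 (fun j : 'I_s.+1 => (j < i)%N) (P i) (fun j => U j k l)
  (P_ge0 i) (fun j ji => U_gt0 j ji k l).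
have UVE := psum_gt0 (fun j : 'I_s.+1 => (j < i)%N) (W i)
  (fun j => (U j + a *: V j) k l) (W_ge0 i) (fun j ji => UV_gt0 j ji k l).
have UV_ge0 : 0 <= \sum_(j < s.+1 | (j < i)%N) W i j * (U j + a *: V j) k l.
  by apply: sumr_ge0 => j ji; rewrite mulr_ge0 // ltW // UV_gt0.
have U_ge0 : 0 <= \sum_(j < s.+1 | (j < i)%N) P i j * U j k l.
  by apply: sumr_ge0 => j ji; rewrite mulr_ge0 // ltW // U_gt0.
have u0_ge0 := mulr_ge0 (r_ge0 i ord0) (ltW (u0_gt0 k l)).
have weights := stage_weights P W i Plow Wlow.
have [r_gt0|r_le0] := ltP 0 (rowsum P W i ord0).
  by rewrite ltr_wpDr // ltr_wpDr // mulr_gt0 // u0_gt0.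
have [p_gt0|p_le0] := ltP 0 (\sum_(j < s.+1 | (j < i)%N) P i j).
  by rewrite ltr_wpDr // ltr_wpDl // UE.
by rewrite ltr_wpDl ?addr_ge0 // UVE; lra.
Qed.

(** Since Q'Q = - C Q, the two implicit terms of a stage add up to
    (dt d / eps + dt^2 |dd| C / eps^2) Q(v): a backward Euler increment whose
    step is nonnegative whatever the value of C at v. *)
Lemma implicit_stage_pos {R : realType} {N n : nat}
    (T Q : 'cV[R]_N -> 'cV[R]_N) (Rop : {linear 'cV[R]_N -> 'cV[R]_n})
    (E : 'cV[R]_n -> 'cV[R]_N) (C : 'cV[R]_n -> R) (dtFE : R)
    (system : relaxation_system T Q Rop E C dtFE)
    (eps dt d dd : R) (x v : 'cV[R]_N) :
  0 < eps -> 0 <= dt -> 0 <= d -> dd <= 0 -> mx_pos x ->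
  v = x + (dt * d) *: (eps^-1 *: Q v)
        + (dt ^+ 2 * dd) *: ((eps ^+ 2)^-1 *: flow_dot Q v) ->
  mx_pos v.
Proof.
move=> eps_gt0 dt_ge0 d_ge0 dd_le0 x_gt0 vE.
apply: (backward_euler_pos system (u := x)
  (dt := dt * d * eps^-1 + dt ^+ 2 * - dd * ((eps ^+ 2)^-1 * C (Rop v)))) => //.
  have C_ge0 := ltW (C_gt0 system v).
  by rewrite addr_ge0 // !mulr_ge0 ?invr_ge0 ?exprn_ge0 ?oppr_ge0 // ltW.
rewrite {1}vE (Q_dotE system) !scalerA -addrA -scalerDl.
by congr (_ + _ *: _); ring.
Qed.

Lemma stiff_imex_step_pos {R : realType} {N n s : nat}
    (T Q : 'cV[R]_N -> 'cV[R]_N) (Rop : {linear 'cV[R]_N -> 'cV[R]_n})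
    (E : 'cV[R]_n -> 'cV[R]_N) (C : 'cV[R]_n -> R) (dtFE : R)
    (system : relaxation_system T Q Rop E C dtFE)
    (r : R) (P W D Dd : 'M[R]_s.+1) (eps dt : R) (u0 : 'cV[R]_N)
    (U : 'I_s.+1 -> 'cV[R]_N) (u1 : 'cV[R]_N) :
  0 < r -> strictly_lower P -> strictly_lower W -> mx_nonneg (rowsum P W) ->
  mx_nonneg P -> mx_nonneg W -> mx_nonneg D -> mx_nonneg (- Dd) ->
  0 < eps -> 0 < dt -> dt <= r * dtFE ->
  stiff_imex_step P W D Dd r T Q eps dt u0 U u1 -> mx_pos u0 -> mx_pos u1.
Proof.
move=> r_gt0 Plow Wlow r_ge0 P_ge0 W_ge0 D_ge0 Dd_le0 eps_gt0 dt_gt0 dt_le.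
move=> [stage ->] u0_gt0.
suff U_gt0 k : forall i : 'I_s.+1, i = k :> nat -> mx_pos (U i) by exact: U_gt0.
elim/ltn_ind: k => k IH i ik.
have prev_gt0 (j : 'I_s.+1) : (j < i)%N -> mx_pos (U j).
  by move=> ji; apply: (IH j) => //; rewrite -ik.
apply: (implicit_stage_pos T Q Rop E C dtFE system eps dt (D i i) (Dd i i)
  (explicit_part P W (dt / r) u0 U (fun j => T (U j)) i)) => //.
- exact: ltW.
- by have := Dd_le0 i i; rewrite mxE oppr_ge0.
- apply: explicit_part_pos => // j ji.
  apply: (forward_euler_pos system); first exact: prev_gt0.
    by rewrite divr_ge0 // ltW.
  by rewrite ler_pdivrMr // mulrC.
Qed.

(** * The limit eps -> 0 *)

Lemma linear_cV_continuous {R : realType} {m n : nat}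
    (L : {linear 'cV[R]_m -> 'cV[R]_n}) : continuous L.
Proof.
have -> : (L : _ -> _) = fun w => \sum_i w i ord0 *: L (delta_mx i ord0).
  apply/funext => w; rewrite {1}(matrix_sum_delta w) linear_sum.
  by apply: eq_bigr => i _; rewrite big_ord1 linearZ.
move=> v.
have FF : Filter (nbhs v) by exact: nbhs_filter.
apply: (cvg_bigsum (F := nbhs v) _ _
  (fun i w => w i ord0 *: L (delta_mx i ord0))) => i _.
by apply: cvgZ; [exact: coord_continuous | exact: cvg_cst].
Qed.

(** In a balance between a bounded quantity, a term of size 1 / eps and one of
    size 1 / eps^2, the dominant nonzero singular coefficient must have a
    vanishing limit factor. *)
Lemma stiff_balance {R : realType} {m : nat} (b c : R)
    (x q qd : R -> 'cV[R]_m) (xl ql qdl : 'cV[R]_m) :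
  (\forall eps \near 0^'+,
     x eps = b *: (eps^-1 *: q eps) + c *: ((eps ^+ 2)^-1 *: qd eps)) ->
  x eps @[eps --> 0^'+] --> xl -> q eps @[eps --> 0^'+] --> ql ->
  qd eps @[eps --> 0^'+] --> qdl ->
  c *: qdl = 0 /\ (c = 0 -> b *: ql = 0).
Proof.
move=> balance xP qP qdP.
have id0 : eps @[eps --> (0 : R)^'+] --> (0 : R).
  by apply: cvg_at_right_filter; exact: cvg_id.
have eps2 : eps ^+ 2 @[eps --> (0 : R)^'+] --> (0 : R).
  by rewrite -[X in _ --> X](mulr0 (0 : R)); exact: cvgM.
have balance' : \forall eps \near (0 : R)^'+, eps != 0
    /\ x eps = b *: (eps^-1 *: q eps) + c *: ((eps ^+ 2)^-1 *: qd eps).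
  near=> eps; split; last by near: eps.
  by apply: lt0r_neq0; near: eps; exact: nbhs_right_gt.
split.
- have lhs : eps ^+ 2 *: x eps - (eps * b) *: q eps @[eps --> 0^'+]
      --> (0 : 'cV[R]_m).
    rewrite -[X in _ --> X](_ : 0 *: xl - (0 * b) *: ql = 0 :> 'cV[R]_m).
      apply: cvgB; apply: cvgZ => //.
      by apply: cvgM => //; exact: cvg_cst.
    by rewrite mul0r !scale0r subr0.
  apply: (norm_cvg_unique _ lhs).
  have rhs : c *: qd eps @[eps --> 0^'+] --> c *: qdl.
    by apply: cvgZ => //; exact: cvg_cst.
  apply: cvg_trans rhs; apply: near_eq_cvg.
  apply: filterS balance' => eps [eps_neq0 ->].
  rewrite scalerDr !scalerA addrAC -scalerBl.
  rewrite (_ : _ - _ = 0) ?scale0r ?add0r; last by field.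
  by congr (_ *: _); field.
- move=> c0.
  have lhs : eps *: x eps @[eps --> 0^'+] --> (0 : 'cV[R]_m).
    by rewrite -[X in _ --> X](scale0r xl); exact: cvgZ.
  apply: (norm_cvg_unique _ lhs).
  have rhs : b *: q eps @[eps --> 0^'+] --> b *: ql.
    by apply: cvgZ => //; exact: cvg_cst.
  apply: cvg_trans rhs; apply: near_eq_cvg.
  apply: filterS balance' => eps [eps_neq0 ->].
  rewrite c0 scale0r addr0 !scalerA.
  by congr (_ *: _); field.
Unshelve. all: by end_near. Qed.

(** [stiff_balance], with x the difference between a stage and its explicit
    part, gives Q = 0 at the limit stage.  Rop kills both singular terms
    exactly, so that the limit of the projected stage equations involves regular
    terms only. *)
Lemma reduces_to_erk_relaxation {R : realType} {N n s : nat}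
    (T Q : 'cV[R]_N -> 'cV[R]_N) (Rop : {linear 'cV[R]_N -> 'cV[R]_n})
    (E : 'cV[R]_n -> 'cV[R]_N) (C : 'cV[R]_n -> R) (dtFE : R)
    (system : relaxation_system T Q Rop E C dtFE)
    (r : R) (P W D Dd : 'M[R]_s.+1) (dt : R) :
  (forall i, 0 < D i i + `|Dd i i|) -> 0 < dt ->
  reduces_to_erk P W D Dd r T Q Rop E dt.
Proof.
move=> Dpos dt_gt0 u0 U u1 u0l Ul u1l step [u0P UP u1P TP QP QdP].
have XP i : explicit_part P W (dt / r) (u0 eps) (U eps)
      (fun j => T (U eps j)) i @[eps --> 0^'+]
    --> explicit_part P W (dt / r) u0l Ul (fun j => T (Ul j)) i.
  by apply: (cvg_explicit_part P W (fun=> dt / r) u0 U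
       (fun eps j => T (U eps j))) => //; exact: cvg_cst.
have Q0 i : Q (Ul i) = 0.
  have [] := stiff_balance (dt * D i i) (dt ^+ 2 * Dd i i)
    (fun eps => U eps i - explicit_part P W (dt / r) (u0 eps) (U eps)
       (fun j => T (U eps j)) i) _ _ _ _ _ _ (cvgB (UP i) (XP i))
    (QP i) (QdP i).
    near=> eps.
    have [stage _] : stiff_imex_step P W D Dd r T Q eps dt (u0 eps) (U eps)
      (u1 eps) by near: eps.
    by apply/eqP; rewrite subr_eq addrC addrA; apply/eqP; exact: stage.
  have [Dd0|/negPf Dd_neq0] := eqVneq (Dd i i) 0.
    rewrite Dd0.
    move=> _ /(_ (mulr0 _)) /eqP; rewrite scaler_eq0 mulf_eq0 (gt_eqF dt_gt0).
    have := Dpos i; rewrite Dd0 normr0 addr0 => /gt_eqF -> /=.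
    by move/eqP.
  move=> + _; rewrite (Q_dotE system) => /eqP.
  rewrite scaler_eq0 mulf_eq0 sqrf_eq0 Dd_neq0 scaler_eq0 oppr_eq0.
  by rewrite (gt_eqF dt_gt0) (gt_eqF (C_gt0 system _)) /= => /eqP.
have eqU i : Ul i = E (Rop (Ul i)) by exact: (equilibrium system).
split=> [i||]; [by rewrite -(Q0 i); exact: QP | exact: eqU |].
have Rcvg (f : R -> 'cV[R]_N) l :
    f eps @[eps --> 0^'+] --> l -> Rop (f eps) @[eps --> 0^'+] --> Rop l.
  by move=> fl; apply: continuous_cvg => //; exact: linear_cV_continuous.
split=> [i|].
- have : Rop (U eps i) @[eps --> 0^'+]
      --> Rop (explicit_part P W (dt / r) u0l Ul (fun j => T (Ul j)) i).
    apply: cvg_trans (Rcvg _ _ (XP i)); apply: near_eq_cvg; near=> eps.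
    have [stage _] : stiff_imex_step P W D Dd r T Q eps dt (u0 eps) (U eps)
      (u1 eps) by near: eps.
    have RQ0 (k : R) : Rop (k *: Q (U eps i)) = 0.
      by rewrite linearZ /= (Rop_Q system) scaler0.
    have -> : U eps i = explicit_part P W (dt / r) (u0 eps) (U eps)
        (fun j => T (U eps j)) i + (dt * D i i) *: (eps^-1 *: Q (U eps i))
        + (dt ^+ 2 * Dd i i) *: ((eps ^+ 2)^-1 *: flow_dot Q (U eps i)).
      exact: stage.
    rewrite (Q_dotE system) !scalerA -addrA -scalerDl.
    by rewrite [RHS]linearD RQ0 addr0.
  move=> /(norm_cvg_unique (Rcvg _ _ (UP i))) ->.
  rewrite linear_explicit_part /explicit_part; congr (_ + _).
  by apply: eq_bigr => j _; rewrite -eqU.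
- congr (Rop _); apply: (norm_cvg_unique u1P).
  apply: cvg_trans (UP ord_max); apply: near_eq_cvg; near=> eps.
  by have [_ ->] : stiff_imex_step P W D Dd r T Q eps dt (u0 eps) (U eps)
    (u1 eps) by near: eps.
Unshelve. all: by end_near. Qed.

(** * Order of the limiting scheme *)

Lemma class_C_cst {R : realType} {m : nat} (k : nat) (a : 'cV[R]_m) :
  class_C k (fun=> a : 'cV[R]_m).
Proof.
elim: k a => [|k IH] a /=; first exact: cst_continuous.
split=> [x|v]; first exact: differentiable_cst.
rewrite (_ : (fun x => _) = fun=> 0); first exact: IH.
by apply/funext => x; rewrite (diff_cst a).
Qed.

Lemma flow_dot_cst0 {R : realType} {m : nat} (u : 'cV[R]_m) :
  flow_dot (fun=> 0 : 'cV[R]_m) u = 0.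
Proof. by rewrite /flow_dot (diff_cst 0). Qed.

(** At step 0 the stages are averages of the initial value; by induction on the
    stages, continuity of the field turns this into convergence. *)
Lemma erk_stages_cvg {R : realType} {s m : nat} (P W : 'M[R]_s.+1) (r : R)
    (H : 'cV[R]_m -> 'cV[R]_m) (y0 : 'cV[R]_m)
    (w : R -> 'I_s.+1 -> 'cV[R]_m) (y1 : R -> 'cV[R]_m) (i : 'I_s.+1) :
  strictly_lower P -> strictly_lower W -> continuous H ->
  (\forall h \near 0^'+, erk_step P W r H h y0 (w h) (y1 h)) ->
  w h i @[h --> 0^'+] --> y0.
Proof.
move=> Plow Wlow Hcont step.
suff wP k : forall i : 'I_s.+1, i = k :> nat -> w h i @[h --> 0^'+] --> y0.
  exact: wP.
elim/ltn_ind: k {i} => k IH i ik.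
have prev (j : 'I_s.+1) : (j < i)%N -> w h j @[h --> 0^'+] --> y0.
  by move=> ji; apply: (IH j) => //; rewrite -ik.
have h0 : h / r @[h --> (0 : R)^'+] --> (0 : R).
  rewrite -[X in _ --> X](mul0r r^-1); apply: cvgM; last exact: cvg_cst.
  by apply: cvg_at_right_filter; exact: cvg_id.
have : explicit_part P W (h / r) y0 (w h) (fun j => H (w h j)) i
    @[h --> 0^'+] --> explicit_part P W 0 y0 (fun=> y0) (fun=> H y0) i.
  apply: (cvg_explicit_part P W (fun h => h / r) (fun=> y0) w
    (fun h j => H (w h j))) => //; first exact: cvg_cst.
  by move=> j ji; apply: continuous_cvg; [exact: Hcont | exact: prev].
rewrite explicit_part_cst // => lim; apply: cvg_trans lim.
apply: near_eq_cvg; near=> h.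
have [stage _] : erk_step P W r H h y0 (w h) (y1 h) by near: h.
by rewrite [RHS]stage.
Unshelve. all: by end_near. Qed.

Lemma imex_order_erk {R : realType} {s : nat} (P W D Dd : 'M[R]_s.+1) (r : R)
    (p : nat) :
  strictly_lower P -> strictly_lower W ->
  imex_order P W D Dd r p -> erk_order P W r p.
Proof.
move=> Plow Wlow order m H y w y1 Hsmooth yH step.
apply: (order m H (fun=> 0) y w y1) => //.
- by move=> k; exact: class_C_cst.
- by rewrite (_ : (fun x => _) = H) //; apply/funext => x; rewrite addr0.
- near=> h.
  have [stage ->] : erk_step P W r H h (y 0) (w h) (y1 h) by near: h.
  by split=> // i; rewrite flow_dot_cst0 !scaler0 !addr0; exact: stage.
- by move=> i; apply: erk_stages_cvg step => //; exact: (Hsmooth 0%N).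
Unshelve. all: by end_near. Qed.

Theorem proposition3p1 (R : realType) (N n s : nat) (n_lt_N : (n < N)%N)
    (T Q : 'cV[R]_N -> 'cV[R]_N) (Rop : {linear 'cV[R]_N -> 'cV[R]_n})
    (E : 'cV[R]_n -> 'cV[R]_N) (C : 'cV[R]_n -> R) (dtFE : R)
    (system : relaxation_system T Q Rop E C dtFE)
    (r : R) (r_gt0 : 0 < r) (P W D Dd : 'M[R]_s.+1)
    (P_lower : strictly_lower P) (W_lower : strictly_lower W)
    (D_diag : is_diag_mx D) (Dd_diag : is_diag_mx Dd)
    (Re_ge0 : mx_nonneg (rowsum P W)) (P_ge0 : mx_nonneg P)
    (W_ge0 : mx_nonneg W) (D_ge0 : mx_nonneg D) (Dd_le0 : mx_nonneg (- Dd)) :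
  (forall (eps dt : R) (u0 : 'cV[R]_N) (U : 'I_s.+1 -> 'cV[R]_N)
          (u1 : 'cV[R]_N),
     0 < eps -> 0 < dt -> dt <= r * dtFE ->
     stiff_imex_step P W D Dd r T Q eps dt u0 U u1 ->
     mx_pos u0 -> mx_pos u1)
  /\ ((forall i, 0 < D i i + `|Dd i i|) ->
      asymptotic_preserving P W D Dd r T Q Rop E).
Proof.
split=> [eps dt u0 U u1|Dpos].
  exact: (stiff_imex_step_pos T Q Rop E C dtFE system).
split=> [dt dt_gt0|p]; last exact: imex_order_erk.
exact: (reduces_to_erk_relaxation T Q Rop E C dtFE system).
Qed.
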